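(* Fix integers $s\geqslant 3$ and $n\geqslant 1$ and let $h_{n,s}=(1,n,n,\dots,n)$ with $s$ entries equal to $n$. Then \[ \alpha_{h_{n,s}}=\sum_{k=0}^{n}\binom{n}{k}k^{\,n-k} \] (with $0^0=1$); in particular it does not depend on $s$. Consequently, setting $\alpha_{h_{0,s}}=1$, \[ \mathrm{Bor}\Big(\sum_{n\geqslant 0}\alpha_{h_{n,s}}t^n\Big)=e^{te^t}. \]
   Context: Let $\mathbb N=\mathbb Z_{\geqslant 0}$ with the componentwise order. A partition in $\mathbb N^n$ is a finite subset $\lambda\subset\mathbb N^n$ closed downward. The degree of a point is the sum of its coordinates; $\lambda_{=i}$, $\lambda_{\geqslant i}$ are the elements of degree $i$, resp. $\geqslant i$; the Hilbert–Samuel function $h_\lambda(i)=|\lambda_{=i}|$ is written as the tuple $(h_\lambda(0),h_\lambda(1),\dots,h_\lambda(\ell))$, $\ell$ the maximal degree. $\mathrm{Soc}(\lambda)$ is the set of maximal elements. For a tuple $h=(1,h_1,\dots,h_\ell)$, $\alpha_h$ is the number of partitions $\lambda\subset\mathbb N^{h_1}$ with $h_\lambda=h$ and $\mathrm{Soc}(\lambda)\subset\lambda_{\geqslant 3}$. $\mathrm{Bor}\colon\mathbb Q[[t]]\to\mathbb Q[[t]]$ sends $\sum f_kt^k\mapsto\sum\frac{f_k}{k!}t^k$. *)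

(* Defs.v *)
From mathcomp Require Import all_boot all_order all_algebra.
Set Implicit Arguments. Unset Strict Implicit. Unset Printing Implicit Defensive.
Import GRing.Theory Num.Theory.

(* Points of N^n are represented inside the finite box {0,..,m-1}^n, as
   n-tuples of 'I_m.  A partition with Hilbert function h = (h_0,...,h_l)
   has all its points of degree <= l, hence all coordinates < size h = l+1,
   so no partition counted by alpha_h is lost. *)

Section Part.
Variables (n m : nat).
Definition pt := n.-tuple 'I_m.

Definition ptle (x y : pt) : bool := [forall i : 'I_n, tnth x i <= tnth y i].
Definition ptdeg (x : pt) : nat := \sum_(i < n) (tnth x i : nat).

Definition is_partition (L : {set pt}) : bool :=
  [forall x in L, forall y, ptle y x ==> (y \in L)].

Definition hilb (L : {set pt}) (i : nat) : nat :=
  #|[set x in L | ptdeg x == i]|.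

Definition socle (L : {set pt}) : {set pt} :=
  [set x in L | [forall y in L, ptle x y ==> (y == x)]].

(* lambda is a partition with h_lambda = h and Soc(lambda) in lambda_{>=3};
   degrees in the box are <= n*(m-1) < (n*m).+1, and h_lambda = h means
   h_lambda(i) = h_i for all i (with h_i = 0 beyond the tuple). *)
Definition alpha_good (h : seq nat) (L : {set pt}) : bool :=
  [&& is_partition L,
      [forall i : 'I_(n * m).+1, hilb L i == nth 0 h i] &
      [forall x in socle L, 3 <= ptdeg x]].

Definition alpha_box (h : seq nat) : nat :=
  #|[set L : {set pt} | alpha_good h L]|.
End Part.

Definition alpha (h : seq nat) : nat := alpha_box (nth 0 h 1) (size h) h.

Definition hns (n s : nat) : seq nat := 1 :: nseq s n.

Local Open Scope ring_scope.
Definition ps := nat -> rat.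
Definition psmul (f g : ps) : ps := fun k => \sum_(i < k.+1) f i * g (k - i)%N.
Fixpoint pspow (f : ps) (j : nat) : ps :=
  match j with
  | 0 => fun k => (k == 0%N)%:R
  | j'.+1 => psmul f (pspow f j')
  end.
(* exp of a series with zero constant term: sum_j f^j / j! ; only j <= k
   contributes to the coefficient of t^k. *)
Definition psexp (f : ps) : ps :=
  fun k => \sum_(j < k.+1) pspow f j k / (j`!)%:R.
Definition psX : ps := fun k => (k == 1%N)%:R.
Definition Bor (f : ps) : ps := fun k => f k / (k`!)%:R.

(* Main.v *)
(** A downset with one element in degree 0 and [n] elements in degrees 1, 2 and
    3, none of degree < 3 maximal, has in degree 2 a graph with loops on the [n]
    vertices, with [n] edges in total. Give each edge total weight 2 over its
    endpoints, an edge from a loopless vertex to a looped one giving all of it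
    to the loopless end. As edges extend to degree 3, every vertex receives
    weight at least 2, hence exactly 2. So looped vertices are pairwise
    nonadjacent, a loopless vertex adjacent to a looped one has no other
    neighbour, and any other vertex has exactly two neighbours. Then each vertex
    can be charged for at most one element of degree 3, each element of degree 3
    is charged to some vertex and a triangle to several, so [n] elements of
    degree 3 leave no room for a triangle. Therefore each vertex [i] is adjacent
    to exactly one looped vertex [f i], [f] is idempotent, and every element of
    degree [d + 1] is [e_i + d e_(f i)]. Thus the partitions counted are in
    bijection with idempotent maps, which are counted by their fixed-point sets;
    on the series side the coefficient of [t^k] in [(t e^t)^j] is
    [j^(k-j) / (k-j)!]. *)
Require Import Defs.
From mathcomp Require Import all_boot all_order all_algebra.
From mathcomp Require Import zify ring.
Set Implicit Arguments. Unset Strict Implicit. Unset Printing Implicit Defensive.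
Import GRing.Theory Num.Theory.

(** * Points of the box as monomials *)

Section Monomials.
Variables (n s : nat).
Implicit Types (t u : seq 'I_n) (x y : pt n s.+1).

(* A list of indices stands for the sum of the corresponding basis vectors; it
   is only meaningful when its size is at most [s]. *)
Definition mono t : pt n s.+1 := [tuple inord (count_mem i t) | i < n].

Lemma tnth_mono t i : size t <= s -> tnth (mono t) i = count_mem i t :> nat.
Proof.
move=> ts; rewrite tnth_mktuple inordK // ltnS.
exact: leq_trans (count_size _ _) ts.
Qed.

Lemma sum_count t : \sum_(i < n) count_mem i t = size t.
Proof.
elim: t => [|a t IH] /=; first by rewrite big1.
rewrite big_split /= IH (bigD1 a) //= eqxx big1 ?addn0 ?add1n // => i /negPf.
by rewrite eq_sym => ->.
Qed.

Lemma ptdeg_mono t : size t <= s -> ptdeg (mono t) = size t.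
Proof.
by move=> ts; rewrite -sum_count; apply: eq_bigr => i _; rewrite tnth_mono.
Qed.

Lemma monoP x : ptdeg x <= s -> exists2 t, size t = ptdeg x & x = mono t.
Proof.
move=> xs; pose t := flatten [seq nseq (tnth x i) i | i <- enum 'I_n].
have count_t i : count_mem i t = tnth x i.
  rewrite count_flatten -map_comp sumnE big_map big_enum /= (bigD1 i) //=.
  rewrite count_nseq /= eqxx mul1n big1 ?addn0 // => j /negPf ji.
  by rewrite count_nseq /= ji.
have tx : size t = ptdeg x.
  by rewrite -sum_count; apply: eq_bigr => i _; rewrite count_t.
exists t => //; apply/eq_from_tnth => i; apply: val_inj.
by rewrite /= tnth_mono ?count_t // tx.
Qed.

Lemma perm_mono t u : perm_eq t u -> mono t = mono u.
Proof.
move=> /permP tu; apply: eq_from_tnth => i.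
by rewrite !tnth_mktuple tu.
Qed.

Lemma mono_eq t u :
  size t <= s -> size u <= s -> (mono t == mono u) = perm_eq t u.
Proof.
move=> ts us; apply/eqP/idP => [tu|]; last exact: perm_mono.
by apply/allP => i _ /=; rewrite -!tnth_mono // tu.
Qed.

Lemma ptle_mono t u : size t <= s -> size u <= s ->
  reflect (forall i, count_mem i t <= count_mem i u) (ptle (mono t) (mono u)).
Proof.
move=> ts us; apply: (iffP forallP) => tu i.
  by have := tu i; rewrite !tnth_mono.
by rewrite !tnth_mono.
Qed.

Lemma leq_ptdeg x y : ptle x y -> ptdeg x <= ptdeg y.
Proof. by move/forallP => xy; apply: leq_sum => i _. Qed.

Lemma ptle_eq x y : ptle x y -> ptdeg y <= ptdeg x -> x = y.
Proof.
move=> /forallP xy yx; apply: eq_from_tnth => i; apply: val_inj.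
have /leqif_sum := fun i (_ : true) => leqif_eq (xy i).
move=> [xy']; rewrite eqn_leq xy' yx => /esym/forallP/(_ i).
by move=> /eqP.
Qed.

End Monomials.

(** * The graph in degree two *)

Lemma perm_pair (T : eqType) (a b c d : T) :
  perm_eq [:: a; b] [:: c; d] =
  ((a, b) == (c, d)) || ((a, b) == (d, c)).
Proof.
apply/idP/idP => [abcd|]; last first.
  by case/orP => /eqP[-> ->] //; apply/permP => p /=; lia.
have := perm_mem abcd a; rewrite !inE eqxx /= => /esym/orP[]/eqP ac; move: abcd.
  by rewrite ac perm_cons => /(@perm_small_eq _ _ [:: _] isT)[->]; rewrite eqxx.
rewrite ac perm_sym (perm_catC [:: c] [:: d]) /= perm_cons perm_sym => /(@perm_small_eq _ _ [:: _] isT)[->].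
by rewrite eqxx orbT.
Qed.

Section Graph.
Variables (T : finType) (R : rel T).
Hypothesis R_sym : symmetric R.

(* Each edge has total weight 2 over its endpoints; a loop, and an edge from a
   vertex without a loop to one with a loop, give it all to the former. *)
Definition edge_weight i j := if i == j then 2 else 1 + R j j - R i i.

Definition vertex_weight i := \sum_(j | R i j) edge_weight i j.

(** An edge is read in both directions by ordered pairs, a loop only once; this is why a loop has
    weight 2. *)
Lemma edge_weight_sum a b :
  \sum_(p : T * T | perm_eq [:: p.1; p.2] [:: a; b]) edge_weight p.1 p.2 = 2.
Proof.
rewrite (eq_bigl (fun p => (p == (a, b)) || (p == (b, a)))); last first.
  by case=> i j; rewrite perm_pair.
rewrite (bigD1 (a, b)) ?eqxx //= /edge_weight.
have [->|ab] := eqVneq a b.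
  by rewrite big1 // => p; rewrite orbb andbN.
rewrite (bigD1 (b, a)) /=; last by rewrite eqxx orbT xpair_eqE negb_and ab orbT.
rewrite big1 ?addn0 => [|p]; last by case: (p == _); case: (p == _).
by rewrite eq_sym (negPf ab); case: (R a a); case: (R b b).
Qed.

Hypothesis weight_ge2 : forall i, 2 <= vertex_weight i.
Hypothesis weight_sum : \sum_i vertex_weight i = 2 * #|T|.

Lemma vertex_weight2 i : vertex_weight i = 2.
Proof.
have [_] := leqif_sum (fun i (_ : true) => leqif_eq (weight_ge2 i)).
by rewrite weight_sum sum_nat_const mulnC eqxx => /esym/forallP/(_ i)/eqP.
Qed.

Lemma edge_weight_le2 i (s : seq T) :
  uniq s -> all (R i) s -> \sum_(j <- s) edge_weight i j <= 2.
Proof.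
move=> s_uniq /allP sR; rewrite -(vertex_weight2 i) /vertex_weight big_uniq //.
rewrite [leqRHS](bigID (mem s)) /=; apply: leq_trans (leq_addr _ _).
rewrite leq_eqVlt; apply/orP; left; apply/eqP/eq_bigl => j /=.
by apply/idP/andP => [js|[]//]; split=> //; apply: sR.
Qed.

(** The loop already weighs 2 at [i]; an edge between two looped vertices would add 1. *)
Lemma loops_nonadjacent i j : R i i -> R j j -> R i j -> i = j.
Proof.
move=> li lj Rij; apply/eqP/negP => /negP ij.
have := @edge_weight_le2 i [:: i; j].
by rewrite /= !inE ij li Rij !big_cons big_nil /edge_weight eqxx (negPf ij) li lj => /(_ isT isT).
Qed.

(** The edge to [j] gives all its weight 2 to [i], and a second neighbour would add at least 1. *)
Lemma nbr_loop_unique i j k : ~~ R i i -> R j j -> R i j -> R i k -> k = j.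
Proof.
move=> /negPf li lj Rij Rik; apply/eqP/negP => /negP kj.
have ij : i != j by apply: contraFN li => /eqP ->.
have ik : i != k by apply: contraFN li => /eqP {2}->.
have := @edge_weight_le2 i [:: j; k].
rewrite /= !inE eq_sym kj Rik Rij !big_cons big_nil /edge_weight (negPf ij) (negPf ik) li lj.
by case: (R k k) => /(_ isT isT).
Qed.

Lemma adj_loop_unique i j k : R j j -> R k k -> R i j -> R i k -> k = j.
Proof.
move=> lj lk Rij Rik; have [li|li] := boolP (R i i).
  by rewrite -(loops_nonadjacent li lj Rij) (loops_nonadjacent li lk Rik).
exact: nbr_loop_unique li lj Rij Rik.
Qed.

Lemma nbr_at_most2 i j k x : ~~ R i i -> R i j -> R i k -> j != k -> R i x ->
  (x == j) || (x == k).
Proof.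
move=> /negPf li Rij Rik jk Rix; apply/negP => /negP; rewrite negb_or => /andP[xj xk].
have nR y : R i y -> i == y = false.
  by move=> Riy; apply: contraFF li => /eqP {2}->.
have := @edge_weight_le2 i [:: x; j; k].
rewrite /= !inE negb_or xj xk jk Rij Rik Rix !big_cons big_nil /edge_weight !nR // li.
by case: (R k k); case: (R j j); case: (R x x) => /(_ isT isT).
Qed.

End Graph.

(** * Good partitions come from idempotent maps *)

Definition star_partition n s (f : 'I_n -> 'I_n) : {set pt n s.+1} :=
  [set x | (x == mono s [::]) ||
           [exists i, exists d : 'I_s, x == mono s (i :: nseq d (f i))]].

Lemma ptdeg_max n s (x : pt n s.+1) : ptdeg x <= n * s.
Proof.
rewrite -[X in X * _]card_ord -sum_nat_const.
by apply: leq_sum => i _; rewrite -ltnS.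
Qed.

Lemma hilb_good n s (L : {set pt n s.+1}) d :
  alpha_good (hns n s) L -> hilb L d = nth 0 (hns n s) d.
Proof.
case/and3P => _ /forallP hL _; case: (ltnP d (n * s.+1).+1) => [dn|nd].
  exact/eqP/(hL (Ordinal dn)).
(* Degrees beyond the tested range: either [d] is past the end of the tuple, where the default is 0,
   or the entries themselves are 0. *)
have sd : s < d \/ n = 0.
  by case: (n) nd => [|n']; [right | left; lia].
rewrite [RHS](_ : _ = 0); last first.
  rewrite /hns; case: d nd sd => [|d] //= _ [sd|->]; rewrite nth_nseq ?if_same //.
  by rewrite ltnNge -ltnS sd.
apply/eqP; rewrite cards_eq0 -subset0; apply/subsetP => x; rewrite inE => /andP[_ /eqP xd].
by have := ptdeg_max x; rewrite xd; move: nd; rewrite mulnS; lia.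
Qed.

Section Good.
Variables (n s : nat) (L : {set pt n s.+1}).
Hypotheses (s_ge3 : 3 <= s) (L_good : alpha_good (hns n s) L).
Let P (t : seq 'I_n) := mono s t \in L.
Let R i j := P [:: i; j].

Lemma card_layer d : d < s -> #|[set x in L | ptdeg x == d.+1]| = n.
Proof.
by move=> ds; have := hilb_good d.+1 L_good; rewrite /hilb /hns /= nth_nseq ds.
Qed.

Lemma ptdeg_good x : x \in L -> ptdeg x <= s.
Proof.
move=> xL; rewrite leqNgt; apply/negP => sx.
have := hilb_good (ptdeg x) L_good; rewrite nth_default; last first.
  by rewrite /= size_nseq.
move/eqP; rewrite cards_eq0 => /eqP/setP/(_ x).
by rewrite !inE xL eqxx.
Qed.

(** The layer has [n] elements, so [n] candidates that cover it must all lie in it. This turns an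
    upper bound on [L] into membership. *)
Lemma layer_image d (h : 'I_n -> pt n s.+1) : d < s ->
  [set x in L | ptdeg x == d.+1] \subset [set h i | i in 'I_n] ->
  [set x in L | ptdeg x == d.+1] = [set h i | i in 'I_n].
Proof.
move=> ds sub; apply/eqP; rewrite eqEcard sub card_layer //.
by rewrite (leq_trans (leq_imset_card _ _)) // card_ord.
Qed.

Lemma good_down t u : size u <= s ->
  (forall i, count_mem i t <= count_mem i u) -> P u -> P t.
Proof.
move=> us tu uL; have ts : size t <= s.
  by rewrite (leq_trans _ us) // -!sum_count; apply: leq_sum => i _.
case/and3P: L_good => /forall_inP/(_ _ uL)/forallP/(_ (mono s t))/implyP Ldown _ _.
by apply/Ldown/ptle_mono.
Qed.

Lemma good_perm t u : perm_eq t u -> P t = P u.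
Proof. by move=> tu; rewrite /P (perm_mono _ tu). Qed.

(** Below degree 3 nothing is maximal, so some larger [y] lies in [L]; raising one coordinate where
    [y] is strictly larger stays below [y]. *)
Lemma good_extend t : size t < 3 -> P t -> exists c, P (c :: t).
Proof.
move=> t3 tL; have ts : size t < s by apply: leq_trans t3 _.
have tns : mono s t \notin socle L.
  case/and3P: L_good => _ _ /forall_inP soc; apply/negP => /soc.
  by rewrite ptdeg_mono ?(ltnW ts) // leqNgt t3.
move: tns; rewrite inE [_ \in L]tL /= negb_forall_in.
case/exists_inP => y yL; rewrite negb_imply => /andP[ty /negP yt].
have ys := ptdeg_good yL; have [u uy yE] := monoP ys; subst y.
have us : size u <= s by rewrite uy.
have /forallPn[c] : ~~ [forall c, count_mem c u <= count_mem c t].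
  apply: contra_notN yt => /forallP ut; apply/eqP/ptle_eq.
    by apply/ptle_mono; rewrite // ltnW.
  exact: leq_ptdeg.
rewrite -ltnNge => ct; exists c; apply: good_down yL => // i /=.
case: eqVneq => [<-|_]; first by rewrite add1n.
by rewrite add0n; move: i; apply/(ptle_mono (ltnW ts) us).
Qed.

Lemma good1 i : P [:: i].
Proof.
have sub : [set x in L | ptdeg x == 1] \subset [set mono s [:: i] | i in 'I_n].
  apply/subsetP => x; rewrite inE => /andP[xL /eqP x1].
  have [t] := monoP (ptdeg_good xL); rewrite x1.
  by case: t => [|a []] // _ ->; apply: imset_f.
have /setP/(_ (mono s [:: i])) := layer_image (ltnW (ltnW s_ge3)) sub.
by rewrite (imset_f (fun i => mono s [:: i])) // inE => /andP[].
Qed.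

Lemma good_subpair a b c : P [:: a; b; c] -> [/\ R a b, R a c & R b c].
Proof.
by move=> abc; split; apply: good_down abc => //= i; lia.
Qed.

Lemma R_sym : symmetric R.
Proof. by move=> i j; apply: good_perm; apply/permP => p /=; lia. Qed.

Lemma weight_ge2 i : 2 <= vertex_weight R i.
Proof.
rewrite /vertex_weight; have [li|nli] := boolP (R i i).
  by rewrite (bigD1 i) //= /edge_weight eqxx.
(* Extend the loopless [i] twice. If the added indices coincide, they carry a loop and their edge
   gives [i] weight 2; otherwise two edges give at least 1 each. *)
have [j Rji] := good_extend (isT : size [:: i] < 3) (good1 i).
have [c /good_subpair[Rcj Rci _]] := good_extend (isT : size [:: j; i] < 3) Rji.
have Rij : R i j by rewrite R_sym.
have Ric : R i c by rewrite R_sym.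
have ij : i != j by apply: contraNneq nli => {2}->.
have ic : i != c by apply: contraNneq nli => {2}->.
rewrite (bigD1 j) //= {1}/edge_weight (negPf ij) (negPf nli) subn0.
have [jc|jc] := eqVneq j c; first by rewrite -jc in Rcj; rewrite Rcj.
rewrite (bigD1 c) /=; last by rewrite Ric eq_sym.
by rewrite {1}/edge_weight (negPf ic) (negPf nli) subn0 addnA; lia.
Qed.

Lemma weight_sum : \sum_i vertex_weight R i = 2 * #|'I_n|.
Proof.
rewrite pair_big_dep /=.
(* Adjacent ordered pairs are grouped by their monomial: [n] groups, each of weight 2. *)
rewrite (partition_big (fun p => mono s [:: p.1; p.2])
          (mem [set x in L | ptdeg x == 2])) /=; last first.
  by case=> i j Rij; rewrite inE ptdeg_mono ?(ltnW s_ge3) // andbT.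
rewrite (eq_bigr (fun=> 2)) => [|x]; last first.
  rewrite inE => /andP[xL /eqP x2]; have [t] := monoP (ptdeg_good xL).
  rewrite x2; case: t => [|a [|b []]] // _ xE; subst x.
  rewrite -(edge_weight_sum R a b); apply: eq_bigl => -[i j] /=.
  rewrite mono_eq ?(ltnW s_ge3) //; case: (boolP (perm_eq _ _)) => [ab|]; last by rewrite andbF.
  by rewrite andbT /R (good_perm ab).
by rewrite sum_nat_const card_layer ?(ltnW s_ge3) // card_ord mulnC.
Qed.

Let adj_loop_unique := adj_loop_unique weight_ge2 weight_sum.
Let nbr_loop_unique := nbr_loop_unique weight_ge2 weight_sum.
Let nbr_at_most2 := nbr_at_most2 weight_ge2 weight_sum.

(* A vertex is charged for its own cube if it carries a loop, and for the
   cubic monomials divisible by it otherwise. *)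
Let charged i (y : pt n s.+1) :=
  (y \in L) && (ptdeg y == 3) &&
  if R i i then y == mono s [:: i; i; i] else ptle (mono s [:: i]) y.

Lemma chargedP i y : ~~ R i i -> charged i y ->
  exists b c, y = mono s [:: i; b; c] /\ P [:: i; b; c].
Proof.
move=> /negPf li /andP[/andP[yL /eqP y3]]; rewrite li.
have [u] := monoP (ptdeg_good yL); rewrite y3 => u3 yE; subst y.
have us : size u <= s by rewrite u3.
have i1 : size [:: i] <= s by apply: leq_trans s_ge3.
move/(ptle_mono i1 us)/(_ i); rewrite /= eqxx addn0 -has_count has_pred1 => iu.
have := perm_to_rem iu; have := size_rem iu; rewrite u3.
case: (rem i u) => [|b [|c []]] // _ ibc; exists b, c.
by rewrite /P -(perm_mono _ ibc).
Qed.

Lemma charged_unique i y y' : charged i y -> charged i y' -> y = y'.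
Proof.
have [li|nli] := boolP (R i i).
  by rewrite /charged li => /andP[_ /eqP->] /andP[_ /eqP->].
move=> /(chargedP nli)[b [c [-> /good_subpair[Rib Ric Rbc]]]].
move=> /(chargedP nli)[b' [c' [-> /good_subpair[Rib' Ric' Rbc']]]].
(* If [b = c], this vertex has a loop and is the only neighbour of [i]. *)
have [bc|bc] := eqVneq b c.
  rewrite -bc in Rbc *.
  by rewrite (nbr_loop_unique nli Rbc Rib Rib') (nbr_loop_unique nli Rbc Rib Ric').
(* Otherwise [b] and [c] are loopless and are the only neighbours of [i]; [b' = c'] would put a loop
   on one of them. *)
have nlb : ~~ R b b.
  by apply: contraNN bc => lb; rewrite (nbr_loop_unique nli lb Rib Ric).
have nlc : ~~ R c c.
  by apply: contraNN bc => lc; rewrite (nbr_loop_unique nli lc Ric Rib).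
apply: perm_mono; rewrite perm_cons perm_pair.
case/orP: (nbr_at_most2 nli Rib Ric bc Rib') Rbc' => /eqP->;
case/orP: (nbr_at_most2 nli Rib Ric bc Ric') => /eqP->; rewrite ?eqxx ?orbT //.
  by rewrite (negPf nlb).
by rewrite (negPf nlc).
Qed.

(** A loop at [a] would leave the loopless [b] with [a] as its sole neighbour, against the edge to
    [c]. *)
Lemma triangle_loopless a b c :
  P [:: a; b; c] -> a != b -> a != c -> b != c -> ~~ R a a.
Proof.
move=> /good_subpair[Rab Rac Rbc] ab ac bc; apply/negP => la.
have nlb : ~~ R b b.
  apply: contraNN ab => lb.
  by rewrite (loops_nonadjacent weight_ge2 weight_sum la lb Rab).
have Rba : R b a by rewrite R_sym.
by rewrite (nbr_loop_unique nlb la Rba Rbc) eqxx in ac.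
Qed.

Lemma charged_cube a : P [:: a; a; a] -> charged a (mono s [:: a; a; a]).
Proof.
move=> aaa; rewrite /charged [_ \in L]aaa ptdeg_mono //=.
by have [-> _ _] := good_subpair aaa; rewrite eqxx.
Qed.

Lemma charged_loopless a b c : ~~ R a a -> P [:: a; b; c] ->
  charged a (mono s [:: a; b; c]).
Proof.
move=> /negPf nla abc; rewrite /charged [_ \in L]abc ptdeg_mono //= nla.
by apply/ptle_mono; rewrite //= ?(ltnW (ltnW s_ge3)) // => i; lia.
Qed.

Lemma charged_square a b : P [:: a; a; b] -> exists i, charged i (mono s [:: a; a; b]).
Proof.
move=> aab; have [ab|ab] := eqVneq a b.
  by rewrite -ab in aab *; exists a; apply: charged_cube.
have [Raa Rab _] := good_subpair aab.
have perm : perm_eq [:: a; a; b] [:: b; a; a] by apply/permP => p /=; lia.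
exists b; rewrite (perm_mono _ perm); apply: charged_loopless; last first.
  by rewrite -(good_perm perm).
apply: contraNN ab => lb.
by rewrite (loops_nonadjacent weight_ge2 weight_sum Raa lb Rab).
Qed.

Lemma charged_ex a b c : P [:: a; b; c] -> exists i, charged i (mono s [:: a; b; c]).
Proof.
move=> abc; have [ab|ab] := eqVneq a b.
  by rewrite -ab in abc *; apply: charged_square.
have [ac|ac] := eqVneq a c.
  have perm : perm_eq [:: a; b; c] [:: a; a; b] by rewrite -ac; apply/permP => p /=; lia.
  by rewrite (perm_mono _ perm); apply: charged_square; rewrite -(good_perm perm).
have [bc|bc] := eqVneq b c.
  have perm : perm_eq [:: a; b; c] [:: b; b; a] by rewrite -bc; apply/permP => p /=; lia.
  by rewrite (perm_mono _ perm); apply: charged_square; rewrite -(good_perm perm).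
by exists a; apply: charged_loopless => //; apply: (triangle_loopless abc).
Qed.

Lemma no_triangle a b c : P [:: a; b; c] -> [|| a == b, a == c | b == c].
Proof.
move=> abc; apply/negP => /negP; rewrite !negb_or => /and3P[ab ac bc].
pose L3 := [set x in L | ptdeg x == 3].
set y0 := mono s [:: a; b; c]; have y0L3 : y0 \in L3.
  by rewrite inE [_ \in L]abc ptdeg_mono.
(* Double counting of the pairs of a vertex and an element it is charged for: at least one per
   element and two for the triangle [y0], but at most one per vertex. *)
suff: n.+1 <= n by rewrite ltnn.
have lower : n.+1 = \sum_(y in L3) (1 + (y == y0)).
  rewrite big_split sum1_card card_layer // -addn1; congr (_ + _).
  by rewrite (bigD1 y0) //= eqxx big1 // => y /andP[_ /negPf->].
rewrite {}lower; apply: (@leq_trans (\sum_(y in L3) \sum_i charged i y)).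
  apply: leq_sum => y; have [-> _|_] := eqVneq y y0.
    have perm : perm_eq [:: a; b; c] [:: b; a; c] by apply/permP => p /=; lia.
    rewrite (bigD1 a) //= (bigD1 b) ?[b == a]eq_sym //= addnA.
    apply: leq_trans (leq_addr _ _); rewrite charged_loopless //; last first.
      exact: (triangle_loopless abc).
    rewrite /y0 (perm_mono _ perm) charged_loopless -?(good_perm perm) //.
    by rewrite (good_perm perm) in abc; apply: (triangle_loopless abc); rewrite // eq_sym.
  rewrite inE => /andP[yL /eqP y3]; have [u] := monoP (ptdeg_good yL).
  rewrite y3; case: u => [|a' [|b' [|c' []]]] // _ yE; subst y.
  by have [i ic] := charged_ex yL; rewrite (bigD1 i) //= ic.
rewrite exchange_big /= -[X in _ <= X]card_ord -sum1_card; apply: leq_sum => i _.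
have [y /andP[yL yc]|none] := pickP (fun y => (y \in L3) && charged i y).
  rewrite (bigD1 y) //= yc big1 // => y' /andP[_ y'y].
  by apply/eqP; rewrite eqb0; apply: contraNN y'y => y'c; rewrite (charged_unique y'c yc).
by rewrite big1 // => y yL; have := none y; rewrite yL /= => ->.
Qed.

(** The extension to degree 3 is not a triangle, so an index repeats in it and carries a loop. *)
Lemma edge_has_loop i j : R i j -> R i i || R j j.
Proof.
move=> Rij; have [c cij] := good_extend (isT : size [:: i; j] < 3) Rij.
have [Rci Rcj _] := good_subpair cij.
case/or3P: (no_triangle cij) => /eqP E.
- by rewrite E in Rci; rewrite Rci.
- by rewrite E in Rcj; rewrite Rcj orbT.
- by rewrite -E in Rij *; rewrite Rij.
Qed.

Lemma adj_loop_ex i : exists k, R k k && R i k.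
Proof.
have [b bi] := good_extend (isT : size [:: i] < 3) (good1 i).
have Rib : R i b by rewrite R_sym.
by case/orP: (edge_has_loop Rib) => l; [exists i | exists b]; rewrite l.
Qed.

Definition centre : {ffun 'I_n -> 'I_n} :=
  [ffun i => xchoose (adj_loop_ex i)].

Lemma centreP i : R (centre i) (centre i) /\ R i (centre i).
Proof. by rewrite ffunE; apply/andP/(xchooseP (adj_loop_ex i)). Qed.

Lemma centre_unique i k : R k k -> R i k -> k = centre i.
Proof.
by have [lc Ric] := centreP i => lk Rik; apply: adj_loop_unique lc lk Ric Rik.
Qed.

Lemma centre_idem i : centre (centre i) = centre i.
Proof. by have [lc _] := centreP i; rewrite -(centre_unique lc lc). Qed.

Lemma good_shape t : 0 < size t <= s -> P t ->
  exists i, perm_eq t (i :: nseq (size t).-1 (centre i)).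
Proof.
case/andP=> t0 ts tL.
(* Take a loopless index of [t] if there is one, any index otherwise. Each remaining index is then a
   looped neighbour of it, hence its centre. *)
have [i it hi] : exists2 i, i \in t & (~~ R i i) || all (fun j => R j j) t.
  case: (boolP (all (fun j => R j j) t)) => [tl|].
    by case: (t) t0 => // i t' _; exists i; rewrite ?mem_head ?orbT.
  by case/allPn => i it nli; exists i; rewrite ?nli.
exists i; have := perm_to_rem it => tE; rewrite (perm_trans tE) // perm_cons.
rewrite -(size_rem it); have -> : rem i t = nseq (size (rem i t)) (centre i); last first.
  by rewrite size_nseq.
apply/all_pred1P/allP => j jt /=; apply/eqP.
have Rij : R i j.
  apply: good_down tL => // k; have /permP -> := tE => /=; rewrite addn0 leq_add2l.
  by case: eqVneq => //= <-; rewrite -has_count has_pred1.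
apply: centre_unique => //; case/orP: hi => [/negPf li|/allP tl].
  by have := edge_has_loop Rij; rewrite li.
exact/tl/mem_rem/jt.
Qed.

Lemma good_star : L = star_partition s centre.
Proof.
apply/setP => x; rewrite inE; apply/idP/orP => [xL|].
  have [t tx xE] := monoP (ptdeg_good xL); subst x.
  have ts := ptdeg_good xL; rewrite -tx in ts.
  have [t0|t0] := posnP (size t); [left | right].
    by move: t0 => /size0nil ->.
  have [i it] := good_shape (introT andP (conj t0 ts)) xL.
  apply/existsP; exists i; have ds : (size t).-1 < s by rewrite prednK.
  by apply/existsP; exists (Ordinal ds); rewrite (perm_mono _ it).
case=> [/eqP ->|/existsP[i /existsP[d /eqP ->]]].
  have /eqP/cards1P[y /setP/(_ y)] := hilb_good 0 L_good.
  rewrite !inE eqxx => /andP[yL /eqP y0].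
  have [t ty yE] := monoP (ptdeg_good yL); subst y.
  by move: ty; rewrite y0 => /size0nil tE; rewrite tE in yL.
(* Converse inclusion by counting: the layer lies among [n] star points and has [n] elements, so it
   contains them all. *)
have sub : [set x in L | ptdeg x == d.+1]
    \subset [set mono s (i :: nseq d (centre i)) | i in 'I_n].
  apply/subsetP => y; rewrite inE => /andP[yL /eqP yd].
  have [t ty yE] := monoP (ptdeg_good yL); subst y.
  have ts := ptdeg_good yL; rewrite -ty in ts; rewrite yd in ty.
  have [j jt] : exists i, perm_eq t (i :: nseq (size t).-1 (centre i)).
    by apply: good_shape; rewrite // ts ty.
  by apply/imsetP; exists j => //; rewrite (perm_mono _ jt) ty.
have /setP/(_ (mono s (i :: nseq d (centre i)))) := layer_image (ltn_ord d) sub.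
by rewrite (imset_f (fun i => mono s (i :: nseq d (centre i)))) // inE => /andP[].
Qed.

End Good.

(** * Idempotent maps give good partitions *)

Section Star.
Variables (n s : nat) (f : 'I_n -> 'I_n).
Hypotheses (s_ge3 : 3 <= s) (f_idem : forall i, f (f i) = f i).

Lemma star_mem i d : d < s -> mono s (i :: nseq d (f i)) \in star_partition s f.
Proof.
move=> ds; rewrite inE; apply/orP; right.
by apply/existsP; exists i; apply/existsP; exists (Ordinal ds).
Qed.

Lemma star_mem0 : mono s [::] \in star_partition s f.
Proof. by rewrite inE eqxx. Qed.

Lemma starP x : x \in star_partition s f ->
  x = mono s [::] \/ exists i d, d < s /\ x = mono s (i :: nseq d (f i)).
Proof.
rewrite inE => /orP[/eqP->|]; first by left.
by case/existsP => i /existsP[d /eqP ->]; right; exists i, d.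
Qed.

(** By idempotence, copies of [f i] form a star point whose leading index is [f i] itself. *)
Lemma star_mem_nseq i e : e <= s -> mono s (nseq e (f i)) \in star_partition s f.
Proof.
case: e => [|e] es; first exact: star_mem0.
by rewrite /= -{2}(f_idem i) star_mem.
Qed.

Lemma star_is_partition : is_partition (star_partition s f).
Proof.
apply/forall_inP => x /starP xL; apply/forallP => y; apply/implyP => yx.
have [t tx] : exists2 t, size t <= s & x = mono s t /\
    (t = [::] \/ exists i d, t = i :: nseq d (f i)).
  case: xL => [->|[i [d [ds ->]]]]; first by exists [::] => //; split; [|left].
  exists (i :: nseq d (f i)); rewrite /= ?size_nseq //; split=> //.
  by right; exists i, d.
case=> {xL} xE tE; subst x; have := leq_ptdeg yx; rewrite ptdeg_mono // => yt.
have ys := leq_trans yt tx; have [u uy yE] := monoP ys; subst y.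
have us : size u <= s by rewrite uy.
rewrite -uy in yt; move/(ptle_mono us tx): yx => ut.
case: tE => [tE|[i [d tE]]]; subst t.
  by move: yt; rewrite leqn0 => /eqP/size0nil ->; apply: star_mem0.
have mem_u j : j \in u -> (j == i) || (j == f i).
  move=> ju; have : 0 < count_mem j (i :: nseq d (f i)).
    by apply: leq_trans (ut j); rewrite -has_count has_pred1.
  by rewrite -has_count has_pred1 inE => /orP[->//|]; rewrite mem_nseq => /andP[_ ->]; rewrite orbT.
(* Either [u] keeps the leading [i], or it consists of copies of [f i] only. *)
have [iu|iu] := boolP (i \in u).
  have uE := perm_to_rem iu.
  suff remE : rem i u = nseq (size (rem i u)) (f i).
    rewrite (perm_mono s uE) remE; apply: star_mem; rewrite size_rem //.
    by rewrite prednK //; case: (u) iu.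
  apply/all_pred1P/allP => j ju /=; have /orP[/eqP ji|//] := mem_u j (mem_rem ju).
  (* A second occurrence of [i] must come from the copies of [f i], so [i = f i]. *)
  rewrite ji in ju *; have := ut i; have /permP -> := uE; rewrite /= eqxx leq_add2l => ci.
  have : 0 < count_mem i (nseq d (f i)).
    by apply: leq_trans ci; rewrite -has_count has_pred1.
  by rewrite -has_count has_pred1 mem_nseq => /andP[].
have -> : u = nseq (size u) (f i); last by apply: star_mem_nseq.
apply/all_pred1P/allP => j ju /=; have /orP[/eqP ji|//] := mem_u j ju.
by rewrite -ji ju in iu.
Qed.


(** If [i != j], equal monomials give [i = f j] and [j = f i], and idempotence then forces
    [i = j]. *)
Lemma star_mono_inj d : d < s -> injective (fun i => mono s (i :: nseq d (f i))).
Proof.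
move=> ds i j /eqP; rewrite mono_eq /= ?size_nseq // => /perm_mem ij.
have := ij i; have := ij j; rewrite !inE !eqxx /= !mem_nseq.
rewrite (eq_sym j i); case: (eqVneq i j) => //= _ /andP[_ /eqP jE].
by move=> /esym/andP[_ /eqP iE]; rewrite iE {1}jE f_idem -jE.
Qed.

Lemma star_hilb d : hilb (star_partition s f) d = nth 0 (hns n s) d.
Proof.
rewrite /hilb /hns; case: d => [|d] /=.
  apply/eqP/cards1P; exists (mono s [::]); apply/setP => x; rewrite !inE.
  apply/andP/eqP => [[]|->]; last by rewrite eqxx ptdeg_mono.
  case/orP => [/eqP ->//|/existsP[i /existsP[e /eqP ->]]].
  by rewrite ptdeg_mono //= size_nseq.
have layer : forall x, x \in star_partition s f -> ptdeg x = d.+1 ->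
    d < s /\ exists i, x = mono s (i :: nseq d (f i)).
  move=> x /starP[->|[i [e [es ->]]]]; rewrite ptdeg_mono //= size_nseq //.
  by case=> <-; split=> //; exists i.
rewrite nth_nseq; case: ltnP => ds; last first.
  apply/eqP; rewrite cards_eq0 -subset0; apply/subsetP => x.
  rewrite inE => /andP[xL /eqP /(layer x xL)[]].
  by rewrite ltnNge ds.
rewrite -[RHS](card_ord n) -(card_imset _ (star_mono_inj ds)).
apply: eq_card => x; rewrite inE; apply/andP/imsetP => [[xL /eqP/(layer x xL)[_ [i ->]]]|].
  by exists i.
by case=> i _ ->; rewrite star_mem // ptdeg_mono //= size_nseq.
Qed.

Lemma star_socle x : 0 < n -> x \in socle (star_partition s f) -> 3 <= ptdeg x.
Proof.
move=> n0; rewrite inE leqNgt => /andP[xL /forall_inP max]; apply/negP => x3.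
(* A point of degree 1 or 2 is raised by one more copy of [f i]; the origin is raised by a basis
   vector, which exists as [n] is positive. *)
have [t [c [ts xE ctL]]] : exists t c, [/\ size t < s, x = mono s t
    & mono s (rcons t c) \in star_partition s f].
  case/starP: xL x3 => [-> _|[i [d [ds ->]]]].
    exists [::], (Ordinal n0); split=> //; first by apply: leq_trans s_ge3.
    by apply: (@star_mem (Ordinal n0) 0); apply: leq_trans s_ge3.
  rewrite ptdeg_mono /= size_nseq // ltnS => d2.
  have d3 : d.+1 < s by apply: leq_ltn_trans s_ge3.
  exists (i :: nseq d (f i)), (f i); split; rewrite //= ?size_nseq //.
  suff -> : rcons (nseq d (f i)) (f i) = nseq d.+1 (f i) by apply: star_mem.
  by rewrite -cats1 cat_nseq /ncons -iterSr.
have := max _ ctL; rewrite xE => /implyP/(_ _)/eqP/(congr1 (@ptdeg _ _)).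
rewrite !ptdeg_mono ?size_rcons ?(ltnW ts) // => H.
suff: (size t).+1 = size t by lia.
apply: H; apply/ptle_mono; rewrite ?size_rcons ?(ltnW ts) // => i.
by rewrite -cats1 count_cat leq_addr.
Qed.

Lemma star_good : 0 < n -> alpha_good (hns n s) (star_partition s f).
Proof.
move=> n0; rewrite /alpha_good star_is_partition /=; apply/andP; split.
  by apply/forallP => d; rewrite star_hilb.
by apply/forall_inP => x; apply: star_socle.
Qed.

Lemma star_mem_pair i j :
  mono s [:: i; j] \in star_partition s f -> (j == f i) || (i == f j).
Proof.
have s2 : 2 <= s by apply: ltnW.
move=> /starP[|[k [d [ds]]]] /eqP; rewrite mono_eq /= ?size_nseq //.
  by move/perm_size.
case: d ds => [_ /perm_size//|[|d] ds]; last by move/perm_size.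
by rewrite perm_pair => /orP[]/eqP[-> ->]; rewrite eqxx ?orbT.
Qed.

End Star.

(** Degree 2 determines the map: the square of [f i] shows that [g] fixes [f i], and then the pair
    of [i] and [f i] gives [g i = f i]. *)
Lemma star_inj n s (f g : 'I_n -> 'I_n) : 3 <= s ->
  (forall i, f (f i) = f i) -> (forall i, g (g i) = g i) ->
  star_partition s f = star_partition s g -> f =1 g.
Proof.
move=> s3 ff gg fg i.
have s1 : 1 < s by apply: ltnW.
have := star_mem f (f i) s1; rewrite fg => /(star_mem_pair s3); rewrite ff orbb => /eqP gfi.
have := star_mem f i s1; rewrite fg => /(star_mem_pair s3) /orP[/eqP//|/eqP iE].
by rewrite -gfi in iE; rewrite -iE in gfi *.
Qed.

(** * Counting idempotent maps *)

Lemma card_idempotent (T : finType) :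
  #|[set f : {ffun T -> T} | [forall i, f (f i) == f i]]| =
  \sum_(k < #|T|.+1) 'C(#|T|, k) * k ^ (#|T| - k).
Proof.
rewrite -sum1_card (partition_big (fun f : {ffun T -> T} => [set i | f i == i]) xpredT) //=.
have fiber (K : {set T}) :
    \sum_(f : {ffun T -> T} | (f \in [set f : {ffun T -> T} | [forall i, f (f i) == f i]])
      && ([set i | f i == i] == K)) 1 = #|K| ^ (#|T| - #|K|).
  (* Idempotent maps with fixed-point set [K] are the identity on [K] and send the complement
     anywhere into [K]: independent choices at each point. *)
  pose F i := if i \in K then (pred1 i : pred T) else mem K.
  rewrite sum1_card; transitivity #|family F|.
    apply: eq_card => f; rewrite unfold_in /= inE; apply/andP/familyP.
      case=> /forallP idf /eqP fixE i; rewrite /F -fixE !inE.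
      by case: ifP => [fi|_]; rewrite ?inE // unfold_in inE.
    move=> Ff; have fK i : f i \in K.
      by have := Ff i; rewrite /F; case: ifP => // iK; rewrite inE => /eqP ->.
    have fid i : i \in K -> f i = i.
      by move=> iK; have := Ff i; rewrite /F iK inE => /eqP.
    split; first by apply/forallP=> i; rewrite fid.
    apply/eqP/setP=> i; rewrite inE; apply/eqP/idP => [<- //|]; exact: fid.
  rewrite card_family foldrE big_map big_enum /= (bigID (mem K)) /=.
  rewrite big1 ?mul1n; last by move=> i iK; rewrite /F iK card1.
  rewrite (eq_bigr (fun=> #|K|)); last by move=> i /negPf iK; rewrite /F iK.
  rewrite prod_nat_const; congr (_ ^ _).
  by rewrite -(cardC (mem K)) addKn.
rewrite (eq_bigr _ (fun K _ => fiber K)).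
rewrite (partition_big (fun K : {set T} => inord #|K| : 'I_#|T|.+1) xpredT) //=.
apply: eq_bigr => k _.
have cardK (K : {set T}) : (inord #|K| == k) = (#|K| == k).
  by rewrite -val_eqE /= inordK // ltnS max_card.
rewrite (eq_bigr (fun=> k ^ (#|T| - k))); last first.
  by move=> K; rewrite cardK => /eqP ->.
rewrite sum_nat_const; congr (_ * _).
rewrite -card_draws; apply: eq_card => K.
by rewrite inE -cardK.
Qed.

Lemma alpha_hns n s : 0 < n -> 3 <= s ->
  alpha (hns n s) = \sum_(k < n.+1) 'C(n, k) * k ^ (n - k).
Proof.
move=> n0 s3; rewrite /alpha /hns /= size_nseq nth_nseq (ltnW (ltnW s3)) -/(hns n s).
rewrite -[in RHS](card_ord n) -card_idempotent /alpha_box.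
rewrite -(@card_in_imset _ _ (fun f : {ffun 'I_n -> 'I_n} => star_partition s f)); last first.
  move=> f g; rewrite !inE => /forallP ff /forallP gg fg; apply/ffunP.
  by apply: (star_inj s3) fg => i; apply/eqP.
apply: eq_card => L; rewrite inE; apply/idP/imsetP => [Lg|[f]].
  exists (centre s3 Lg); last exact: good_star.
  by rewrite inE; apply/forallP => i; apply/eqP/centre_idem.
rewrite inE => /forallP ff ->; apply: star_good => // i; exact/eqP.
Qed.

(** * Exponential generating series *)

Section PowerSeries.
Local Open Scope ring_scope.

Lemma pspow_psX j k : pspow psX j k = (k == j)%:R.
Proof.
elim: j k => [//|j IH] k /=; rewrite /psmul.
case: k => [|k]; first by rewrite big_ord1 mul0r.
rewrite (bigD1 (inord 1)) //= inordK // mul1r subn1 /= IH big1 ?addr0 //.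
move=> i; rewrite -val_eqE /= inordK // => /negPf i1.
by rewrite /psX i1 mul0r.
Qed.

Lemma psexp_psX k : psexp psX k = (k`!)%:R^-1.
Proof.
rewrite /psexp (bigD1 ord_max) //= pspow_psX eqxx mul1r big1 ?addr0 // => i.
by rewrite -val_eqE /= eq_sym => /negPf ik; rewrite pspow_psX ik mul0r.
Qed.

(** This is $(te^t)^j = t^j e^{jt}$ read coefficientwise. *)
Lemma pspow_psX_exp j k :
  pspow (psmul psX (psexp psX)) j k =
  if (j <= k)%N then (j ^ (k - j))%:R / ((k - j)`!)%:R else 0.
Proof.
have psXexp i : psmul psX (psexp psX) i.+1 = (i`!)%:R^-1.
  rewrite /psmul (bigD1 (inord 1)) //= inordK // mul1r subn1 psexp_psX /=.
  rewrite big1 ?addr0 // => l; rewrite -val_eqE /= inordK // => /negPf l1.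
  by rewrite /psX l1 mul0r.
have psXexp0 : psmul psX (psexp psX) 0%N = 0 by rewrite /psmul big_ord1 mul0r.
have factN0 i : (i`!)%:R != 0 :> rat by rewrite pnatr_eq0 -lt0n fact_gt0.
elim: j k => [|j IH] k.
  by case: k => [|k] //=; rewrite subn0 exp0n // mul0r.
case: k => [|k] /=; rewrite {1}/psmul.
  by rewrite big_ord1 psXexp0 mul0r.
rewrite big_ord_recl /= psXexp0 mul0r add0r ltnS.
pose F i : rat := (i`!)%:R^-1 *
  (if (j <= k - i)%N then (j ^ (k - i - j))%:R / ((k - i - j)`!)%:R else 0).
rewrite (eq_bigr (fun i : 'I_k.+1 => F i)) => [|i _]; last first.
  by rewrite /bump /= add1n psXexp subSS IH.
case: leqP => [jk|kj]; last first.
  rewrite big1 // => i _; rewrite /F leqNgt.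
  by rewrite (leq_ltn_trans (leq_subr _ _) kj) mulr0.
(* Terms with index above [k - j] vanish; the others match the binomial expansion of
   $(j+1)^{k-j}$. *)
rewrite subSS -(big_mkord xpredT F) (@big_cat_nat _ _ _ (k - j).+1) //=; last first.
  by rewrite ltnS leq_subr.
rewrite [X in _ + X]big_nat [X in _ + X]big1 ?addr0 => [|i /andP[di ik]]; last first.
  rewrite /F ifF ?mulr0 //; lia.
rewrite big_mkord -(addn1 j) expnDn natr_sum mulr_suml; apply: eq_bigr => i _.
have id : (i <= k - j)%N by rewrite -ltnS.
rewrite /F ifT; last by lia.
rewrite subnAC exp1n muln1 natrM.
have /(congr1 (fun x => x%:R : rat)) := bin_fact id; rewrite !natrM => <-.
field; rewrite !factN0 pnatr_eq0 -lt0n bin_gt0 //.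
Qed.

(** Dividing $\binom{k}{j}$ by $k!$ leaves $1/(j!\,(k-j)!)$, so the two sums agree term by term. *)
Lemma Bor_idempotent_sum (a : nat -> nat) k :
  (forall n, a n = \sum_(k < n.+1) 'C(n, k) * k ^ (n - k))%N ->
  Bor (fun n => (a n)%:R) k = psexp (psmul psX (psexp psX)) k.
Proof.
move=> aE; rewrite /Bor /psexp aE natr_sum mulr_suml; apply: eq_bigr => j _.
have jk : (j <= k)%N by rewrite -ltnS.
rewrite pspow_psX_exp jk natrM.
have factN0 i : (i`!)%:R != 0 :> rat by rewrite pnatr_eq0 -lt0n fact_gt0.
have /(congr1 (fun x => x%:R : rat)) := bin_fact jk; rewrite !natrM => <-.
field; rewrite !factN0 pnatr_eq0 -lt0n bin_gt0 //.
Qed.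

End PowerSeries.

Theorem theorem5p4 (s : nat) (hs : (3 <= s)%N) :
  (forall n : nat, (1 <= n)%N ->
     alpha (hns n s) = \sum_(k < n.+1) 'C(n, k) * k ^ (n - k))
  /\
  (forall k : nat,
     Bor (fun n => ((if n == 0%N then 1%N else alpha (hns n s))%:R : rat)) k
     = psexp (psmul psX (psexp psX)) k).
Proof.
split=> [n n0|k]; first exact: alpha_hns.
apply: (@Bor_idempotent_sum (fun n => if n == 0 then 1 else alpha (hns n s))) => n.
(* At [n = 0] the sum has the single term $0^0 = 1$, which agrees with the convention. *)
by case: posnP => [->|n0]; [rewrite big_ord1 | apply: alpha_hns].
Qed.
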